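(* Let $g,h>0$, $l_0\ge1$, $\alpha\in(0,1)$. Suppose $(S_t)$ is $l_0$-sub-Bernoulli with variance process $(V_t)$ and range parameters $g,h$, while $(-S_t)$ is $l_0$-sub-Bernoulli with variance process $(V_t)$ and range parameters $h,g$. Fix any $\rho>gh$, let $r=\rho-gh$, and define $$f_{g,h}(v)=\sup\left\{s\in\left[0,\tfrac{r+v}{g}\right):\ m_{g,h}(s,v)<\frac{l_0}{\alpha}\right\},$$ $$m_{g,h}(s,v)=\frac{(g+h)^{v/gh}}{\left[g^{v/h+s}\,h^{v/g-s}\right]^{1/(g+h)}}\cdot\frac{B_1\left(\frac{r+v-gs}{g(g+h)},\frac{r+v+hs}{h(g+h)}\right)}{B_1\left(\frac{r}{g(g+h)},\frac{r}{h(g+h)}\right)},$$ and let $f_{h,g}$ be defined by the same formulas with the roles of $g$ and $h$ exchanged. Then $$\mathbb{P}\left(\forall t\ge1:\ -f_{h,g}(V_t)<S_t<f_{g,h}(V_t)\right)\ge1-\alpha.$$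
   Context: $B_x(a,b)=\int_0^xp^{a-1}(1-p)^{b-1}\,dp$ is the incomplete Beta function, so $B_1$ is the ordinary Beta function. Sub-$\psi$ condition: let $(S_t)_{t=0}^\infty$, $(V_t)_{t=0}^\infty$ be real-valued processes adapted to a filtration $(\mathcal F_t)_{t=0}^\infty$ with $S_0=V_0=0$ and $V_t\ge 0$ for all $t$. For $\psi:[0,\lambda_{\max})\to\mathbb{R}$ and $l_0\in[1,\infty)$, $(S_t)$ is $l_0$-sub-$\psi$ with variance process $(V_t)$ if for each $\lambda\in[0,\lambda_{\max})$ there is a supermartingale $(L_t(\lambda))_{t=0}^\infty$ with respect to $(\mathcal F_t)$ with $\mathbb{E}L_0(\lambda)\le l_0$ and $\exp\{\lambda S_t-\psi(\lambda)V_t\}\le L_t(\lambda)$ a.s. for all $t$. Sub-Bernoulli with range parameters $g,h>0$ means sub-$\psi$ with $\psi(\lambda)=\psi_{B,g,h}(\lambda)=\frac1{gh}\log\left(\frac{ge^{h\lambda}+he^{-g\lambda}}{g+h}\right)$ on $[0,\infty)$ (the scaled cumulant-generating function of a centered random variable supported on $-g$ and $h$). *)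

(* Defs.v *)
From HB Require Import structures.
From mathcomp Require Import all_boot all_order all_algebra.
From mathcomp Require Import all_classical all_reals all_analysis.
Set Implicit Arguments.
Unset Strict Implicit.
Unset Printing Implicit Defensive.
Import Order.TTheory GRing.Theory Num.Theory numFieldNormedType.Exports.
Local Open Scope classical_set_scope.
Local Open Scope ring_scope.

(* A sub-sigma-algebra of the ambient one is given by the set of its events. *)
Definition is_filtration d (T : measurableType d)
    (F : nat -> set_system T) : Prop :=
  (forall t, sigma_algebra setT (F t)) /\
  (forall t, F t `<=` measurable) /\
  (forall t, F t `<=` F t.+1).

Definition measurable_wrt (R : realType) (T : Type) (G : set_system T)
    (X : T -> R) : Prop :=
  forall B : set R, measurable B -> G (X @^-1` B).

Definition adapted (R : realType) (T : Type) (F : nat -> set_system T)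
    (X : nat -> T -> R) : Prop :=
  forall t, measurable_wrt (F t) (X t).

Definition is_cond_expectation d (T : measurableType d) (R : realType)
    (P : probability T R) (G : set_system T) (X Y : T -> R) : Prop :=
  measurable_wrt G Y /\
  P.-integrable setT (EFin \o Y) /\
  (forall A, G A ->
    (\int[P]_(w in A) (Y w)%:E = \int[P]_(w in A) (X w)%:E)%E).

(* Conditional expectations are unique up to P-null events, so the last clause
   does not depend on the version Y. *)
Definition supermartingale d (T : measurableType d) (R : realType)
    (P : probability T R) (F : nat -> set_system T)
    (L : nat -> T -> R) : Prop :=
  adapted F L /\
  (forall t, P.-integrable setT (EFin \o L t)) /\
  (forall t, exists Y : T -> R,
    is_cond_expectation P (F t) (L t.+1) Y /\
    {ae P, forall w, Y w <= L t w}).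

(* psi is only used on [0, lmax[, where lmax may be +oo. *)
Definition sub_psi d (T : measurableType d) (R : realType)
    (P : probability T R) (F : nat -> set_system T) (lmax : \bar R)
    (psi : R -> R) (l0 : R) (S V : nat -> T -> R) : Prop :=
  forall lambda : R, 0 <= lambda -> (lambda%:E < lmax)%E ->
  exists L : nat -> T -> R,
    supermartingale P F L /\
    ('E_P[L 0%N] <= l0%:E)%E /\
    (forall t, {ae P, forall w,
      expR (lambda * S t w - psi lambda * V t w) <= L t w}).

Definition psi_bernoulli (R : realType) (g h lambda : R) : R :=
  (g * h)^-1 *
  ln ((g * expR (h * lambda) + h * expR (- (g * lambda))) / (g + h)).

Definition sub_bernoulli d (T : measurableType d) (R : realType)
    (P : probability T R) (F : nat -> set_system T) (g h l0 : R)
    (S V : nat -> T -> R) : Prop :=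
  sub_psi P F +oo%E (psi_bernoulli g h) l0 S V.

(* The library's beta_fun only takes natural-number parameters. *)
Definition incomplete_beta (R : realType) (x a b : R) : R :=
  \int[lebesgue_measure]_(p in `[0, x])
    (p `^ (a - 1) * (1 - p) `^ (b - 1)).

Definition beta_binomial_mixture (R : realType) (r g h s v : R) : R :=
  (g + h) `^ (v / (g * h)) /
    (g `^ (v / h + s) * h `^ (v / g - s)) `^ (g + h)^-1 *
  (incomplete_beta 1 ((r + v - g * s) / (g * (g + h)))
                     ((r + v + h * s) / (h * (g + h))) /
   incomplete_beta 1 (r / (g * (g + h))) (r / (h * (g + h)))).

Definition beta_binomial_boundary (R : realType) (r l0 alpha g h v : R) : R :=
  sup [set s : R | 0 <= s < (r + v) / g /\
                   beta_binomial_mixture r g h s v < l0 / alpha].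

(* Main.v *)
(** For [0 < x < 1] put [lambda(x) = ln ((1 - x) h / (x g)) / (g + h)], which is
    of either sign.  The supermartingale hypotheses on [S] and [- S] together give,
    for every [x], a supermartingale dominating
    [exp (lambda(x) S - psi (lambda(x)) V)], and the latter is a constant times
    [x^p (1 - x)^q] with [p], [q] affine in [(S, V)].  Averaging over a Beta law in
    [x] therefore gives the mixture [m(S, V)], which is [>= l0 / alpha] whenever
    one of the two boundaries is crossed, at infinite value when
    [S >= (r + V) / g].  No measurability of the supermartingales in [lambda] is
    available, so rather than mixing them one stops each of them at the first
    crossing time, a time that does not depend on [x]; the mixture is taken
    afterwards on the explicit exponentials, by Tonelli, and this yields
    [(l0 / alpha) P (crossing) <= l0]. *)
Require Import Defs.
From HB Require Import structures.
From mathcomp Require Import all_boot all_order all_algebra.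
From mathcomp Require Import all_classical all_reals all_analysis.
From mathcomp Require Import measurable_realfun.
From mathcomp Require Import ring lra.
Import Order.TTheory GRing.Theory Num.Theory numFieldNormedType.Exports.
Local Open Scope classical_set_scope.
Local Open Scope ring_scope.

(** * Beta integrals *)

(** Lebesgue measure is determined by its values on the intervals []a, b]], and the preimage [[1 -
    b, 1 - a[] of such an interval has the same length. *)
Lemma lebesgue_measure_onem (R : realType) (A : set R) : measurable A ->
  pushforward lebesgue_measure
    (fun x : measurableTypeR R => 1 - x : measurableTypeR R) A =
  lebesgue_measure A.
Proof.
have mf : measurable_fun setT
  (fun x : measurableTypeR R => 1 - x : measurableTypeR R) by exact: measurable_funB.
move=> mA; apply/esym.
apply: (@lebesgue_measure_unique R (pushforward lebesgue_measure
  (fun x : measurableTypeR R => 1 - x : measurableTypeR R))) => //= _ [[a b]] _ <-.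
rewrite /pushforward.
have -> : (fun x : R => 1 - x) @^-1` `]a, b]%classic = `[1 - b, 1 - a[%classic.
  by apply/seteqP; split => x /=; rewrite !in_itv/= => /andP[? ?]; apply/andP; split; lra.
rewrite !lebesgue_measure_itv/= !lte_fin.
have -> : (1 - b < 1 - a) = (a < b) by apply/idP/idP; lra.
by case: ifP => // _; rewrite -!EFinB; congr EFin; ring.
Qed.

Lemma ge0_integral_onem (R : realType) (f : R -> \bar R) :
  measurable_fun setT f -> (forall x, 0 <= f x)%E ->
  (\int[lebesgue_measure]_(x in `]0%R, 1%R[) f x =
   \int[lebesgue_measure]_(x in `]0%R, 1%R[) f (1 - x)%R)%E.
Proof.
move=> mf f0.
have mphi : measurable_fun setT (fun x : measurableTypeR R => 1 - x : measurableTypeR R).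
  by apply: measurable_funB => //.
have E : `]0%R, 1%R[%classic =
    (fun x : measurableTypeR R => 1 - x : measurableTypeR R) @^-1` `]0%R, 1%R[%classic.
  by apply/seteqP; split => x /=; rewrite !in_itv/= => /andP[? ?]; apply/andP; split; lra.
rewrite [in RHS]E -(ge0_integral_pushforward mphi)//=; last first.
  exact: measurable_funTS.
apply: eq_measure_integral => //= A mA AS.
by rewrite lebesgue_measure_onem.
Qed.

Section beta_integral.
Context {R : realType}.
Implicit Types a b x : R.

(** Valued in the extended reals so that divergence reads [+oo]; the real-valued [incomplete_beta]
    would collapse a divergent integral to 0. *)
Definition beta_integral a b : \bar R :=
  (\int[lebesgue_measure]_(x in `]0%R, 1%R[)
     (x `^ (a - 1) * (1 - x) `^ (b - 1))%:E)%E.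

Lemma measurable_beta_integrand a b :
  measurable_fun setT (fun x : R => x `^ a * (1 - x) `^ b).
Proof.
apply: measurable_funM; first exact: measurable_powR.
by apply: (measurableT_comp (measurable_powR b)); exact: measurable_funB.
Qed.

Lemma beta_integral_sym a b : beta_integral a b = beta_integral b a.
Proof.
rewrite /beta_integral ge0_integral_onem.
- by apply: eq_integral => x _; rewrite mulrC; congr ((_ `^ _ * _)%:E); ring.
- by apply/measurable_EFinP; exact: measurable_beta_integrand.
- by move=> x; rewrite lee_fin mulr_ge0// powR_ge0.
Qed.

Lemma incomplete_beta1E a b : incomplete_beta 1 a b = fine (beta_integral a b).
Proof.
rewrite /incomplete_beta /Rintegral /beta_integral integral_itv_bndoo//.
apply/measurable_EFinP.
by apply: measurable_funTS; exact: measurable_beta_integrand.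
Qed.

Lemma integral_powR (a x y : R) : 0 < x -> x < y -> a != 0 ->
  (\int[lebesgue_measure]_(z in `[x, y]) (z `^ (a - 1))%:E =
   (y `^ a / a - x `^ a / a)%:E)%E.
Proof.
move=> x0 xy a0.
have y0 : 0 < y by exact: lt_trans xy.
have dz z : 0 < z -> derivable (fun z : R => z `^ a / a) z 1.
  move=> z0; apply: derivableM; last exact: derivable_cst.
  by apply: derivable_powR; rewrite in_itv/= z0.
rewrite (@continuous_FTC2 _ _ (fun z => z `^ a / a))//.
- apply: derivable_within_continuous => z; rewrite in_itv/= => /andP[xz _].
  by apply: derivable_powR; rewrite in_itv/= (lt_le_trans x0 xz).
- have cz z : 0 < z -> {for z, continuous (fun z : R => z `^ a / a)}.
    by move=> z0; apply: differentiable_continuous; apply/derivable1_diffP; exact: dz.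
  split.
  + by move=> z; rewrite in_itv/= => /andP[xz _]; apply: dz; exact: lt_trans xz.
  + by apply: cvg_at_right_filter; exact: cz.
  + by apply: cvg_at_left_filter; exact: cz.
- move=> z; rewrite in_itv/= => /andP[xz _].
  have z0 : 0 < z by exact: lt_trans xz.
  rewrite derive1E deriveM//; last by apply: derivable_powR; rewrite in_itv/= z0.
  rewrite derive_cst scaler0 add0r -derive1E powR_derive1 ?in_itv/= ?z0//.
  by rewrite /GRing.scale/= mulrA mulVf ?mul1r.
Qed.

(** Monotone convergence along intervals shrinking to the singularity at 0: on each of them the
    antiderivative [x^a / a] bounds the integral by [1 / a]. *)
Lemma beta_integral_powR_lty a : 0 < a ->
  (\int[lebesgue_measure]_(x in `]0%R, 1%R[) (x `^ (a - 1))%:E < +oo)%E.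
Proof.
move=> a0.
(* With [n.+2] the left endpoint is strictly below 1, as [integral_powR] demands even for
   [n = 0]. *)
pose F (n : nat) : set R := `[n.+2%:R^-1, 1]%classic.
have F01 : \bigcup_n F n = `]0, 1]%classic.
  apply/seteqP; split => x /=.
    move=> [n _]; rewrite /F/= !in_itv/= => /andP[nx ->]; rewrite andbT.
    by apply: lt_le_trans nx; rewrite invr_gt0.
  rewrite in_itv/= => /andP[x0 x1]; exists (Num.truncn x^-1) => //.
  rewrite /F/= in_itv/= x1 andbT invf_ple ?posrE//.
  by rewrite (le_trans (ltW (truncnS_gt _)))// ler_nat.
have mp : measurable_fun setT (fun x : R => (x `^ (a - 1))%:E).
  by apply/measurable_EFinP; exact: measurable_powR.
have cvgF : (\int[lebesgue_measure]_(x in F n) (x `^ (a - 1))%:E @[n --> \oo]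
   --> \int[lebesgue_measure]_(x in \bigcup_n F n) (x `^ (a - 1))%:E)%E.
  apply: ge0_nondecreasing_set_cvg_integral.
  - move=> m n mn; rewrite subsetEset => x; rewrite /F/= !in_itv/= => /andP[mx ->].
    by rewrite andbT (le_trans _ mx)// lef_pV2 ?posrE// ler_nat.
  - by move=> i; exact: measurable_itv.
  - by move=> i; exact: measurable_funTS.
  - by move=> i x _; rewrite lee_fin powR_ge0.
rewrite (@integral_itv_bndo_bndc _ (BRight 0)); last exact: measurable_funTS.
rewrite -F01 (@le_lt_trans _ _ (a^-1)%:E) ?ltry//.
rewrite -(cvg_lim _ cvgF)//; apply: lime_le; first by apply/cvg_ex; eexists; exact: cvgF.
apply: nearW => n.
rewrite integral_powR ?gt_eqF// ?invr_gt0// ?invf_lt1 ?ltr1n//.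
by rewrite lee_fin powR1 div1r gerBl divr_ge0 ?powR_ge0// ltW.
Qed.

Lemma powR_le1 x a : 0 <= x <= 1 -> 0 <= a -> x `^ a <= 1.
Proof.
move=> /andP[x0 x1] a0; have -> : 1 = 1 `^ a :> R by rewrite powR1.
by rewrite ge0_ler_powR ?nnegrE.
Qed.

(** The two endpoint singularities separate: the integrand is at most [x^(a-1) + (1-x)^(b-1)], and
    each summand is integrable, the second by reflection. *)
Lemma beta_integral_lty a b : 0 < a -> 0 < b -> (beta_integral a b < +oo)%E.
Proof.
move=> a0 b0; rewrite /beta_integral.
have mp c : measurable_fun setT (fun x : R => (x `^ (c - 1))%:E).
  by apply/measurable_EFinP; exact: measurable_powR.
have mpc c : measurable_fun setT (fun x : R => ((1 - x) `^ (c - 1))%:E).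
  apply/measurable_EFinP; apply: (measurableT_comp (measurable_powR _)).
  exact: measurable_funB.
apply: (@le_lt_trans _ _ (\int[lebesgue_measure]_(x in `]0%R, 1%R[)
   ((x `^ (a - 1))%:E + ((1 - x) `^ (b - 1))%:E)))%E.
  apply: ge0_le_integral => //.
  - by move=> x _; rewrite lee_fin mulr_ge0 ?powR_ge0.
  - apply: measurable_funTS; apply/measurable_EFinP.
    exact: measurable_beta_integrand.
  - by apply: emeasurable_funD; apply: measurable_funTS; [exact: mp|exact: mpc].
  move=> x /=; rewrite in_itv/= => /andP[x0 x1]; rewrite lee_fin.
  have x1' : 0 < 1 - x by lra.
  (* [1 / (x (1 - x)) = 1 / x + 1 / (1 - x)] *)
  have -> : x `^ (a - 1) * (1 - x) `^ (b - 1) =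
     x `^ (a - 1) * (1 - x) `^ b + (1 - x) `^ (b - 1) * x `^ a.
    rewrite -(@mulr_powRB1 _ (1 - x) b) ?ltW// -(@mulr_powRB1 _ x a) ?ltW//.
    by ring.
  have x01 : 0 <= x <= 1 by rewrite !ltW.
  have x01' : 0 <= 1 - x <= 1 by rewrite ltW//= gerBl ltW.
  by apply: lerD; rewrite ger_pMr ?powR_gt0// powR_le1// ltW.
rewrite ge0_integralD//; last 4 first.
- by move=> x _; rewrite lee_fin powR_ge0.
- by apply: measurable_funTS; exact: mp.
- by move=> x _; rewrite lee_fin powR_ge0.
- by apply: measurable_funTS; exact: mpc.
apply: lte_add_pinfty; first exact: beta_integral_powR_lty.
rewrite ge0_integral_onem//.
- under eq_integral do rewrite subKr.
  exact: beta_integral_powR_lty.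
- by move=> x; rewrite lee_fin powR_ge0.
Qed.

Lemma integral_powRN1 x : 0 < x < 2^-1 ->
  (\int[lebesgue_measure]_(z in `[x, 2^-1%R]) (z `^ (-1))%:E =
   (ln 2^-1 - ln x)%:E)%E.
Proof.
move=> /andP[x0 xy].
have dl z : 0 < z -> derivable (@ln R) z 1.
  by move=> z0; have := is_derive1_ln z0; case.
rewrite (@continuous_FTC2 _ _ (@ln R))//.
- apply: continuous_in_subspaceT => z; rewrite inE/= in_itv/= => /andP[xz _].
  have z0 : 0 < z by exact: lt_le_trans xz.
  apply: differentiable_continuous; apply/derivable1_diffP.
  by apply: derivable_powR; rewrite in_itv/= z0.
- split.
  + by move=> z; rewrite in_itv/= => /andP[xz _]; apply: dl; exact: lt_trans xz.
  + by apply: cvg_at_right_filter; exact: continuous_ln.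
  + by apply: cvg_at_left_filter; exact: continuous_ln.
- move=> z; rewrite in_itv/= => /andP[xz _].
  have z0 : 0 < z by exact: lt_trans xz.
  by rewrite powR_inv1 ?ltW// derive1E; have := is_derive1_ln z0; case.
Qed.

Lemma beta_integral_ge0 a b : (0 <= beta_integral a b)%E.
Proof.
by apply: integral_ge0 => x _; rewrite lee_fin mulr_ge0 ?powR_ge0.
Qed.

(** The integrand vanishes nowhere on []0, 1[], so a zero integral would make this interval of
    measure 1 negligible. *)
Lemma beta_integral_gt0 a b : (0 < beta_integral a b)%E.
Proof.
rewrite lt0e beta_integral_ge0 andbT; apply/eqP => J0.
pose f x : \bar R := (x `^ (a - 1) * (1 - x) `^ (b - 1))%:E.
pose D : set R := `]0, 1[%classic.
have mf : measurable_fun D f.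
  by apply/measurable_EFinP; apply: measurable_funTS; exact: measurable_beta_integrand.
have N0 : ae_eq lebesgue_measure D f (cst 0%E).
  apply/(ae_eq_integral_abs lebesgue_measure (measurable_itv _) mf); rewrite -J0.
  apply: eq_integral => x _.
  by rewrite gee0_abs// lee_fin mulr_ge0 ?powR_ge0.
have /negligibleP : (@lebesgue_measure R).-negligible D.
  apply: negligibleS N0 => x /= x01 /(_ x01) /eqP.
  move: x01; rewrite /D/= in_itv/= => /andP[x0 x1].
  have x1' : 0 < 1 - x by rewrite subr_gt0.
  by rewrite /f /cst eqe mulf_eq0 !powR_eq0 (gt_eqF x0) (gt_eqF x1').
move=> /(_ (measurable_itv _)) muD0.
have muD1 : lebesgue_measure D = 1%E.
  by rewrite lebesgue_measure_itv/= lte_fin ltr01 oppr0 adde0.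
by have /eqP := etrans (esym muD1) muD0; rewrite eqe oner_eq0.
Qed.

(** On [[x, 1/2]] the integrand is at least [d / z] with [d = 2^(-b)], since [z^(a-1) >= z^(-1)] and
    [(1-z)^(b-1) >= (1-z)^b >= d]. The resulting logarithmic lower bound is unbounded as [x] tends
    to 0. *)
Lemma beta_integral_pinfty a b : a <= 0 -> 0 < b -> beta_integral a b = +oo%E.
Proof.
move=> a0 b0.
have := beta_integral_ge0 a b; case E : beta_integral => [j| |]//.
rewrite lee_fin => j0; exfalso.
pose d : R := 2^-1 `^ b.
have d0 : 0 < d by rewrite powR_gt0.
have lower x : 0 < x < 2^-1 -> d * (ln 2^-1 - ln x) <= j.
  move=> xh; have /andP[x0 _] := xh.
  rewrite -lee_fin -E EFinM -integral_powRN1// -ge0_integralZl//=; last 3 first.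
  - by apply/measurable_EFinP; apply: measurable_funTS; exact: measurable_powR.
  - by move=> z _; rewrite lee_fin powR_ge0.
  - by rewrite lee_fin ltW.
  apply: (@le_trans _ _ (\int[lebesgue_measure]_(z in `[x, 2^-1%R])
     (z `^ (a - 1) * (1 - z) `^ (b - 1))%:E)%E); last first.
    apply: ge0_subset_integral => //.
    - by apply: measurable_funTS; apply/measurable_EFinP; exact: measurable_beta_integrand.
    - by move=> z _; rewrite lee_fin mulr_ge0 ?powR_ge0.
    - by move=> z/=; rewrite !in_itv/= => /andP[? ?]; apply/andP; split; lra.
  apply: ge0_le_integral => //=.
  - by move=> z _; rewrite lee_fin mulr_ge0 ?powR_ge0 ?ltW.
  - apply/measurable_EFinP; apply: measurable_funTS.
    by apply: measurable_funM; last exact: measurable_powR.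
  - by apply: measurable_funTS; apply/measurable_EFinP; exact: measurable_beta_integrand.
  move=> z; rewrite in_itv/= => /andP[xz zh].
  have z0 : 0 < z by exact: lt_le_trans xz.
  rewrite lee_fin mulrC; apply: ler_pM; [exact: powR_ge0|exact: ltW| |].
    apply: ger_powR; first by apply/andP; split; lra.
    by lra.
  apply: (@le_trans _ _ ((1 - z) `^ b)).
    by apply: ge0_ler_powR; rewrite ?nnegrE; lra.
  by apply: ger_powR; [apply/andP; split; lra|lra].
have jd0 : 0 <= j / d by rewrite divr_ge0// ltW.
(* This [x] makes the lower bound equal to [d * (j / d + 1) = j + d], which exceeds [j]. *)
have := lower (expR (ln 2^-1 - (j / d + 1))).
rewrite expR_gt0 expRK -[in X in _ < X](@lnK _ 2^-1) ?posrE ?invr_gt0// ltr_expR.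
have -> : ln 2^-1 - (j / d + 1) < ln 2^-1 :> R by lra.
have -> : ln 2^-1 - (ln 2^-1 - (j / d + 1)) = j / d + 1 by ring.
move=> /(_ isT).
by rewrite mulrDr mulr1 mulrCA divff ?gt_eqF// mulr1; lra.
Qed.

End beta_integral.

(** * The Beta mixture of exponentials *)

Section mixture.
Context {R : realType}.
Implicit Types g h r s v x : R.

Lemma powR_expR_ln x a : 0 < x -> x `^ a = expR (a * ln x).
Proof. by move=> x0; rewrite /powR gt_eqF. Qed.

(* Under the change of variables [lambda = tilt x] the exponential
   supermartingale becomes a product of powers of [x] and [1 - x]. *)
Definition tilt g h x : R := (ln (1 - x) + ln h - ln x - ln g) / (g + h).

Definition kernel g h s v x : R :=
  expR (tilt g h x * s - psi_bernoulli g h (tilt g h x) * v).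

(** Unnormalised density of the mixing Beta law; its total mass is the mixture at [s = v = 0]. *)
Definition weight r g h x : R :=
  x `^ (r / (g * (g + h)) - 1) * (1 - x) `^ (r / (h * (g + h)) - 1).

Definition mixture_integral r g h s v : \bar R :=
  (\int[lebesgue_measure]_(x in `]0%R, 1%R[)
     (kernel g h s v x * weight r g h x)%:E)%E.

Definition mixture_factor g h s v : R :=
  (g + h) `^ (v / (g * h)) /
    (g `^ (v / h + s) * h `^ (v / g - s)) `^ (g + h)^-1.

(** By [exp u >= 1 + u] on both exponentials: the linear terms [g h l] and [- h g l] cancel, leaving
    [g + h] as a lower bound for the numerator. *)
Lemma psi_bernoulli_ge0 g h l : 0 < g -> 0 < h -> 0 <= psi_bernoulli g h l.
Proof.
move=> g0 h0; rewrite /psi_bernoulli mulr_ge0//.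
  by rewrite invr_ge0 mulr_ge0 ?ltW.
apply: ln_ge0; rewrite ler_pdivlMr ?addr_gt0// mul1r.
have h1 : g * (1 + h * l) <= g * expR (h * l) by rewrite ler_pM2l// expR_ge1Dx.
have h2 : h * (1 + - (g * l)) <= h * expR (- (g * l)).
  by rewrite ler_pM2l// expR_ge1Dx.
have -> : g + h = g * (1 + h * l) + h * (1 + - (g * l)) by ring.
exact: lerD.
Qed.

(** This lets the hypothesis on [- S], with ranges exchanged, supply the negative values of
    lambda. *)
Lemma psi_bernoulliN g h l : psi_bernoulli h g (- l) = psi_bernoulli g h l.
Proof.
rewrite /psi_bernoulli !mulrN opprK (mulrC h g) (addrC h g).
by rewrite (addrC (h * _)).
Qed.

(** For [l = tilt g h x] one has [exp (- (g + h) l) = x g / ((1 - x) h)], hence the sum of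
    exponentials inside the logarithm collapses to [g exp (h l) / (1 - x)]. *)
Lemma psi_bernoulli_tilt g h x : 0 < g -> 0 < h -> 0 < x < 1 ->
  psi_bernoulli g h (tilt g h x) =
  (g * h)^-1 * (h * tilt g h x + ln g - ln (1 - x) - ln (g + h)).
Proof.
move=> g0 h0 /andP[x0 x1].
have y0 : 0 < 1 - x by lra.
have gh0 : 0 < g + h by rewrite addr_gt0.
have gh : g + h != 0 by rewrite gt_eqF.
rewrite /psi_bernoulli; congr (_ * _).
have -> : - (g * tilt g h x) = h * tilt g h x + (ln x + ln g - ln (1 - x) - ln h).
  by rewrite /tilt; field.
set l := tilt g h x.
have -> : g * expR (h * l) + h * expR (h * l + (ln x + ln g - ln (1 - x) - ln h))
   = g * expR (h * l) / (1 - x).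
  rewrite expRD !expRD !expRN !lnK ?posrE//; field.
  by rewrite !gt_eqF.
rewrite !ln_div ?posrE ?mulr_gt0 ?expR_gt0 ?invr_gt0//; last first.
rewrite lnM ?posrE ?expR_gt0// expRK; ring.
Qed.

(** Beta conjugacy. Each side is one exponential of a linear form in the logarithms of [x], [1 - x],
    [g], [h] and [g + h], and the coefficients agree. *)
Lemma kernel_weightE r g h s v x : 0 < g -> 0 < h -> 0 < x < 1 ->
  kernel g h s v x * weight r g h x =
  mixture_factor g h s v *
  (x `^ ((r + v - g * s) / (g * (g + h)) - 1) *
   (1 - x) `^ ((r + v + h * s) / (h * (g + h)) - 1)).
Proof.
move=> g0 h0 x01; have /andP[x0 x1] := x01.
have y0 : 0 < 1 - x by lra.
have gh0 : 0 < g + h by rewrite addr_gt0.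
rewrite /kernel /weight /mixture_factor psi_bernoulli_tilt// /tilt.
rewrite -powRN !(powR_expR_ln g) // !(powR_expR_ln h)// -expRD.
rewrite !(powR_expR_ln (expR _)) ?expR_gt0// expRK.
rewrite !powR_expR_ln// -!expRD; congr expR.
field; by rewrite !gt_eqF.
Qed.

Lemma mixture_factor_gt0 g h s v : 0 < g -> 0 < h -> 0 < mixture_factor g h s v.
Proof.
move=> g0 h0; rewrite /mixture_factor divr_gt0 ?powR_gt0 ?addr_gt0//.
by rewrite mulr_gt0 ?powR_gt0.
Qed.

Lemma mixture_integralE r g h s v : 0 < g -> 0 < h ->
  mixture_integral r g h s v = ((mixture_factor g h s v)%:E *
    beta_integral ((r + v - g * s) / (g * (g + h)))%R
                  ((r + v + h * s) / (h * (g + h)))%R)%E.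
Proof.
move=> g0 h0; rewrite /mixture_integral /beta_integral -ge0_integralZl//.
- apply: eq_integral => x; rewrite inE/= in_itv/= => x01.
  by rewrite -EFinM kernel_weightE.
- apply: measurable_funTS; apply/measurable_EFinP.
  exact: measurable_beta_integrand.
- by move=> x _; rewrite lee_fin mulr_ge0 ?powR_ge0.
- by rewrite lee_fin ltW// mixture_factor_gt0.
Qed.

Lemma mixture_integral00 r g h : 0 < g -> 0 < h ->
  mixture_integral r g h 0 0 =
  beta_integral (r / (g * (g + h))) (r / (h * (g + h))).
Proof.
move=> g0 h0; rewrite mixture_integralE// /mixture_factor.
by rewrite !mulr0 !mul0r !addr0 !subr0 !powRr0 mulr1 powR1 divr1 mul1e.
Qed.

(** The reflection of [x] to [1 - x] swaps the two Beta parameters. Both boundaries are thereby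
    governed by one and the same mixture. *)
Lemma mixture_integralN r g h s v : 0 < g -> 0 < h ->
  mixture_integral r h g (- s) v = mixture_integral r g h s v.
Proof.
move=> g0 h0; rewrite (mixture_integralE _ _ _ _ _ h0 g0) (mixture_integralE _ _ _ _ _ g0 h0).
rewrite beta_integral_sym /mixture_factor (addrC h g) (mulrC h g) !mulrN !opprK.
by rewrite (mulrC (h `^ _)).
Qed.

Lemma mixture_integral_lty r g h s v : 0 < g -> 0 < h ->
  g * s < r + v -> - (h * s) < r + v -> (mixture_integral r g h s v < +oo)%E.
Proof.
move=> g0 h0 gs hs; rewrite mixture_integralE// lte_mul_pinfty//.
- by rewrite lee_fin ltW// mixture_factor_gt0.
- apply: beta_integral_lty; apply: divr_gt0; try lra.
    by rewrite mulr_gt0 ?addr_gt0.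
  by rewrite mulr_gt0 ?addr_gt0.
Qed.

Lemma mixture_integral_pinfty r g h s v : 0 < g -> 0 < h ->
  r + v <= g * s -> - (h * s) < r + v -> mixture_integral r g h s v = +oo%E.
Proof.
move=> g0 h0 gs hs; rewrite mixture_integralE// beta_integral_pinfty.
- by rewrite gt0_muley// lte_fin mixture_factor_gt0.
- rewrite mulr_le0_ge0 ?invr_ge0//; first lra.
  by rewrite mulr_ge0 ?addr_ge0// ltW.
- apply: divr_gt0; first lra.
  by rewrite mulr_gt0 ?addr_gt0.
Qed.

Lemma weight_ge0 r g h x : 0 <= weight r g h x.
Proof. by rewrite mulr_ge0 ?powR_ge0. Qed.

Lemma kernel_weight_ge0 r g h s v x : 0 <= kernel g h s v x * weight r g h x.
Proof. by rewrite mulr_ge0 ?weight_ge0 ?expR_ge0. Qed.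

Lemma mixture_integral_ge0 r g h s v : (0 <= mixture_integral r g h s v)%E.
Proof. by apply: integral_ge0 => x _; rewrite lee_fin kernel_weight_ge0. Qed.

Lemma measurable_tilt g h : measurable_fun setT (tilt g h).
Proof.
apply: measurable_funM => //; apply: measurable_funB => //.
apply: measurable_funB; last exact: measurable_ln.
apply: measurable_funD => //; apply: measurableT_comp; first exact: measurable_ln.
exact: measurable_funB.
Qed.

Lemma measurable_psi_bernoulli g h : measurable_fun setT (@psi_bernoulli R g h).
Proof.
apply: measurable_funM => //; apply: measurableT_comp; first exact: measurable_ln.
apply: measurable_funM => //; apply: measurable_funD; apply: measurable_funM => //.
  by apply: measurableT_comp => //; exact: measurable_funM.
apply: measurableT_comp => //; apply: measurable_funN; exact: measurable_funM.
Qed.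

Lemma measurable_weight r g h : measurable_fun setT (weight r g h).
Proof. exact: measurable_beta_integrand. Qed.

Lemma measurable_kernel g h d (T : measurableType d) (S V : T -> R) (X : T -> R) :
  measurable_fun setT S -> measurable_fun setT V -> measurable_fun setT X ->
  measurable_fun setT (fun w => kernel g h (S w) (V w) (X w)).
Proof.
move=> mS mV mX; apply: measurableT_comp => //; apply: measurable_funB.
  by apply: measurable_funM => //; apply: measurableT_comp => //; exact: measurable_tilt.
apply: measurable_funM => //; apply: measurableT_comp.
  exact: measurable_psi_bernoulli.
by apply: measurableT_comp => //; exact: measurable_tilt.
Qed.

Lemma measurable_kernel_weight r g h s v :
  measurable_fun setT (fun x => kernel g h s v x * weight r g h x).
Proof.
apply: measurable_funM; last exact: measurable_weight.
exact: measurable_kernel.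
Qed.

(** Pointwise in [x], because [psi_bernoulli] is nonnegative. *)
Lemma mixture_integral_nonincreasing r g h s : 0 < g -> 0 < h ->
  {homo mixture_integral r g h s : v v' / v <= v' >-> (v' <= v)%E}.
Proof.
move=> g0 h0 v v' vv'; apply: ge0_le_integral => //.
- by move=> x _; rewrite lee_fin kernel_weight_ge0.
- by apply: measurable_funTS; apply/measurable_EFinP; exact: measurable_kernel_weight.
- by apply: measurable_funTS; apply/measurable_EFinP; exact: measurable_kernel_weight.
move=> x _; rewrite lee_fin ler_wpM2r ?weight_ge0// ler_expR lerB//.
by rewrite ler_wpM2l// psi_bernoulli_ge0.
Qed.

(** For fixed [x] the kernel is the exponential of an affine function of [s], and convexity survives
    integration. It takes the place of continuity in [s] at the boundary. *)
Lemma mixture_integral_convex r g h v s s' (t : R) : 0 <= t <= 1 ->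
  (mixture_integral r g h ((1 - t) * s + t * s')%R v <=
   (1 - t)%:E * mixture_integral r g h s v + t%:E * mixture_integral r g h s' v)%E.
Proof.
move=> /andP[t0 t1]; have t1' : 0 <= 1 - t by lra.
pose D : set R := `]0, 1[%classic.
have mD : measurable D by exact: measurable_itv.
have mkw z : measurable_fun D
    (fun x : R => (kernel g h z v x * weight r g h x)%:E).
  by apply: measurable_funTS; apply/measurable_EFinP; exact: measurable_kernel_weight.
have kw0 z x : (0 <= (kernel g h z v x * weight r g h x)%:E)%E.
  by rewrite lee_fin kernel_weight_ge0.
have Z k z : 0 <= k -> (k%:E * mixture_integral r g h z v =
    \int[lebesgue_measure]_(x in D) (k%:E * (kernel g h z v x * weight r g h x)%:E))%E.
  by move=> k0; rewrite ge0_integralZl//; exact: mkw.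
rewrite !Z// -ge0_integralD//; first last.
- by apply: measurable_funeM; exact: mkw.
- by move=> x _; rewrite mule_ge0.
- by apply: measurable_funeM; exact: mkw.
- by move=> x _; rewrite mule_ge0.
apply: ge0_le_integral => //.
- exact: mkw.
- by apply: emeasurable_funD; apply: measurable_funeM; exact: mkw.
move=> x _; rewrite -!EFinM -EFinD lee_fin (mulrA (1 - t)) (mulrA t) -mulrDl.
rewrite ler_wpM2r ?weight_ge0//.
set l := tilt g h x; set p := psi_bernoulli g h l.
have -> : kernel g h ((1 - t) * s + t * s') v x =
    expR ((1 - t) * (l * s - p * v) + t * (l * s' - p * v)).
  by rewrite /kernel -/l -/p; congr expR; ring.
have convex_expR (a b : R) : expR ((1 - t) * a + t * b) <= (1 - t) * expR a + t * expR b.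
  set m := (1 - t) * a + t * b.
  (* Tangent line at the barycentre [m]; averaged over [a] and [b], the tangent values give exactly
     [expR m]. *)
  have tangent z : expR m * (1 + (z - m)) <= expR z.
    have -> : expR z = expR m * expR (z - m) by rewrite -expRD subrKC.
    by rewrite ler_pM2l ?expR_gt0// expR_ge1Dx.
  apply: (@le_trans _ _ ((1 - t) * (expR m * (1 + (a - m))) +
                         t * (expR m * (1 + (b - m))))).
    rewrite le_eqVlt; apply/orP; left; apply/eqP; rewrite /m; ring.
  by apply: lerD; rewrite ler_wpM2l.
exact: convex_expR.
Qed.

End mixture.

(** * The boundary *)

Section boundary.
Context {R : realType}.
Variables (r l0 alpha g h : R).
Hypotheses (r0 : 0 < r) (g0 : 0 < g) (h0 : 0 < h).

Implicit Types s v : R.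

Let J0 : \bar R := mixture_integral r g h 0 0.

Lemma mixture_integral00_gt0 : (0 < J0)%E.
Proof. by rewrite /J0 mixture_integral00// beta_integral_gt0. Qed.

Lemma mixture_integral00_lty : (J0 < +oo)%E.
Proof. by apply: mixture_integral_lty; rewrite // ?mulr0 ?oppr0 addr0. Qed.

Lemma mixture_integral00_fin_num : J0 \is a fin_num.
Proof.
by rewrite ge0_fin_numE ?mixture_integral00_lty// ltW ?mixture_integral00_gt0.
Qed.

Let j0_gt0 : 0 < fine J0.
Proof. by rewrite fine_gt0// mixture_integral00_gt0 mixture_integral00_lty. Qed.

Lemma beta_binomial_mixtureE s v : 0 <= s -> 0 <= v -> s < (r + v) / g ->
  beta_binomial_mixture r g h s v = fine (mixture_integral r g h s v) / fine J0.
Proof.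
move=> s0 v0 sg; rewrite /beta_binomial_mixture !incomplete_beta1E.
rewrite /J0 mixture_integral00// mulrA; congr (_ / _).
rewrite mixture_integralE// fineM//.
rewrite ge0_fin_numE ?beta_integral_ge0//.
move: sg; rewrite ltr_pdivlMr// => sg.
have hs : 0 <= h * s by rewrite mulr_ge0// ltW.
apply: beta_integral_lty; apply: divr_gt0.
- by rewrite subr_gt0 mulrC.
- by rewrite mulr_gt0 ?addr_gt0.
- by rewrite ltr_wpDr// ltr_wpDr.
- by rewrite mulr_gt0 ?addr_gt0.
Qed.

Lemma boundary_mixture_fin_num s v : 0 <= s -> 0 <= v -> s < (r + v) / g ->
  mixture_integral r g h s v \is a fin_num.
Proof.
move=> s0 v0; rewrite ltr_pdivlMr// => sg.
have hs : 0 <= h * s by rewrite mulr_ge0// ltW.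
rewrite ge0_fin_numE ?mixture_integral_ge0//.
by apply: mixture_integral_lty => //; move: r0; lra.
Qed.

Let c := l0 / alpha.
Let f := beta_binomial_boundary r l0 alpha g h.
Let A v : set R := [set s : R | 0 <= s < (r + v) / g /\
                   beta_binomial_mixture r g h s v < c].

Let fE v : f v = sup (A v). Proof. by []. Qed.

Let A_ubound v : has_ubound (A v).
Proof. by exists ((r + v) / g) => s /= [/andP[_ /ltW]]. Qed.

Let f_ge0 v : 0 <= f v.
Proof.
(* The supremum of the empty set is 0 by convention. *)
have [A0|/set0P[s As]] := eqVneq (A v) set0.
  by rewrite fE A0 sup0.
have [/andP[s0 _] _] := As.
exact: le_trans s0 (ub_le_sup (A_ubound v) As).
Qed.

(** The admissible set grows with [v]: its range widens and the mixture decreases. Monotonicity is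
    what makes the boundary Borel. *)
Lemma boundary_nondecreasing v v' : 0 <= v -> v <= v' -> f v <= f v'.
Proof.
move=> v0 vv'.
have [A0|/set0P An0] := eqVneq (A v) set0.
  by rewrite (fE v) A0 sup0 f_ge0.
have AA : A v `<=` A v'.
  move=> s /= [/andP[s0 sv] msv].
  have v'0 : 0 <= v' by exact: le_trans vv'.
  have sv' : s < (r + v') / g.
    by rewrite (lt_le_trans sv)// ler_pM2r ?invr_gt0// lerD2l.
  split; first by rewrite s0.
  apply: le_lt_trans msv.
  rewrite (beta_binomial_mixtureE _ _ s0 v0 sv) (beta_binomial_mixtureE _ _ s0 v'0 sv').
  have j0V : 0 <= (fine J0)^-1 by rewrite invr_ge0 ltW.
  apply: (ler_wpM2r j0V); apply: fine_le.
  - exact: boundary_mixture_fin_num.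
  - exact: boundary_mixture_fin_num.
  - exact: mixture_integral_nonincreasing.
rewrite !fE.
apply: sup_le; [move=> s /AA As|exact: An0|].
- by apply/downP; exists s.
- by split; [case: An0 => s /AA As; exists s|exact: A_ubound].
Qed.

(** Truncating at 0 extends the monotonicity, known for [v >= 0], to the whole line. *)
Lemma measurable_boundary : measurable_fun setT (fun v => f (Num.max v 0)).
Proof.
apply: nondecreasing_measurable; first exact: measurableT.
move=> v v' vv'; apply: boundary_nondecreasing.
  by rewrite le_max lexx orbT.
by rewrite ge_max !le_max vv' lexx !orbT.
Qed.

(** Beyond [(r + v) / g] the mixture is infinite. Below it, a value under [c * J0] at [s] would
    persist, by convexity, at some [s' > s]; then [s'] is admissible and exceeds the supremum. *)
Lemma boundary_crossed s v : 0 <= v -> f v <= s ->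
  (c%:E * J0 <= mixture_integral r g h s v)%E.
Proof.
move=> v0 fs; have s0 : 0 <= s by exact: le_trans fs.
have [sg|sg] := leP ((r + v) / g) s.
  have hs : 0 <= h * s by rewrite mulr_ge0// ltW.
  rewrite mixture_integral_pinfty ?leey//; last by move: r0; lra.
  by move: sg; rewrite ler_pdivrMr// mulrC.
rewrite leNgt; apply/negP.
have ge0_fin x : (0 <= x)%E -> x \is a fin_num -> exists2 y : R, 0 <= y & x = y%:E.
  by move=> x0 xfin; exists (fine x); rewrite ?fine_ge0 ?fineK.
have [n n0 nE] := ge0_fin _ (mixture_integral_ge0 r g h s v)
  (boundary_mixture_fin_num _ _ s0 v0 sg).
rewrite nE -(fineK mixture_integral00_fin_num) -EFinM lte_fin.
move: (fine J0) j0_gt0 (beta_binomial_mixtureE) => j j0 mE ncj.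
(* Any point strictly between [s] and the end of the range serves: the mixture is finite there. *)
pose s1 := (s + (r + v) / g) / 2.
have ss1 : s < s1 by rewrite /s1; lra.
have s1g : s1 < (r + v) / g by rewrite /s1; lra.
have s10 : 0 <= s1 by lra.
have [n1 n10 n1E] := ge0_fin _ (mixture_integral_ge0 r g h s1 v)
  (boundary_mixture_fin_num _ _ s10 v0 s1g).
(* [e] is the slack at [s]; the weight [t] below is small enough that [t * n1 < e], so
   [(1 - t) * n + t * n1] stays under [c * j]. *)
pose e := c * j - n.
have e0 : 0 < e by rewrite /e; lra.
pose t := e / (e + n1 + 1).
have d0 : 0 < e + n1 + 1 by lra.
have t0 : 0 < t by rewrite divr_gt0.
have t1 : t < 1 by rewrite ltr_pdivrMr//; lra.
have tn1 : t * n1 < e.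
  by rewrite /t mulrAC ltr_pdivrMr// ltr_pM2l//; lra.
pose s' := (1 - t) * s + t * s1.
have ss' : s < s'.
  have : 0 < t * (s1 - s) by rewrite mulr_gt0// subr_gt0.
  by rewrite /s'; lra.
have s's1 : s' <= s1.
  have : 0 <= (1 - t) * (s1 - s) by rewrite mulr_ge0// subr_ge0 ltW.
  by rewrite /s'; lra.
have s'g : s' < (r + v) / g by exact: le_lt_trans s1g.
have s'0 : 0 <= s' by lra.
have As' : A v s'.
  split; first by rewrite s'0.
  rewrite (mE _ _ s'0 v0 s'g) (ltr_pdivrMr _ _ j0).
  have := @mixture_integral_convex _ r g h v s s1 t.
  rewrite (ltW t0) (ltW t1) nE n1E => /(_ isT).
  have [n' _ n'E] := ge0_fin _ (mixture_integral_ge0 r g h s' v)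
    (boundary_mixture_fin_num _ _ s'0 v0 s'g).
  rewrite n'E -!EFinM -EFinD lee_fin => /le_lt_trans; apply.
  have : 0 <= t * n by rewrite mulr_ge0// ltW.
  by move: tn1; rewrite /e; lra.
have : s' <= f v by exact: (ub_le_sup (A_ubound v) As').
lra.
Qed.

End boundary.

(** * Stopping at the first crossing *)

(** Positive and negative parts are compared separately, so integrands of either sign are covered,
    as required for the processes [L]. *)
Lemma ae_le_integral d (T : measurableType d) (R : realType)
    (mu : {measure set T -> \bar R}) (D : set T) (f g : T -> \bar R) :
  measurable D -> measurable_fun D f -> measurable_fun D g ->
  {ae mu, forall x, f x <= g x}%E ->
  (\int[mu]_(x in D) f x <= \int[mu]_(x in D) g x)%E.
Proof.
move=> mD mf mg fg; rewrite integralE [leRHS]integralE; apply: leeB.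
- apply: ae_ge0_le_integral => //; [exact: measurable_funepos|exact: measurable_funepos|].
  apply: filterS fg => x fgx _.
  by rewrite !funeposE ge_max !le_max fgx lexx orbT.
- apply: ae_ge0_le_integral => //; [exact: measurable_funeneg|exact: measurable_funeneg|].
  apply: filterS fg => x fgx _.
  by rewrite !funenegE ge_max !le_max leeN2 fgx lexx orbT.
Qed.

(** * Events and random variables of a sub-sigma-algebra *)

Section sub_sigma_algebra.
Context {T : pointedType} {R : realType} (G : set_system T).
Hypothesis sG : sigma_algebra setT G.

Lemma sigma_algebra_setC A : G A -> G (~` A).
Proof. by case: sG => _ GD _ /GD; rewrite setTD. Qed.

Lemma sigma_algebra_setT : G setT.
Proof. by case: sG => G0 _ _; rewrite -setC0; exact: sigma_algebra_setC. Qed.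

Lemma sigma_algebra_setU A B : G A -> G B -> G (A `|` B).
Proof.
case: sG => _ _ GU GA GB; rewrite -bigcup2E; apply: GU => -[|[|n]]//=.
by case: sG.
Qed.

Lemma sigma_algebra_setI A B : G A -> G B -> G (A `&` B).
Proof.
move=> GA GB; rewrite -(setCK (A `&` B)) setCI; apply: sigma_algebra_setC.
by apply: sigma_algebra_setU; exact: sigma_algebra_setC.
Qed.

Lemma sigma_algebra_setD A B : G A -> G B -> G (A `\` B).
Proof.
by move=> GA GB; rewrite setDE; apply: sigma_algebra_setI => //; exact: sigma_algebra_setC.
Qed.

(** A sigma-algebra generates itself; this gives access to the closure properties of
    [measurable_fun]. *)
Lemma measurable_wrt_g_sigma (X : T -> R) :
  measurable_wrt G X <->
  measurable_fun [set: g_sigma_algebraType G] X.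
Proof.
split=> [mX _ B mB|mX B mB].
  rewrite setTI; apply: sub_sigma_algebra; exact: mX.
by have := mX measurableT _ mB; rewrite setTI /measurable/= sigma_algebra_id.
Qed.

Lemma measurable_wrt_le (X Y : T -> R) : measurable_wrt G X -> measurable_wrt G Y ->
  G [set w | X w <= Y w].
Proof.
move=> /measurable_wrt_g_sigma mX /measurable_wrt_g_sigma mY.
have /measurable_wrt_g_sigma mYX : measurable_fun [set: g_sigma_algebraType G]
   (fun w => Y w - X w) by exact: measurable_funB.
have := mYX `[0, +oo[%classic (measurable_itv _).
by congr G; apply/seteqP; split => w/=; rewrite in_itv/= andbT subr_ge0.
Qed.

Lemma measurable_wrt_comp (phi : R -> R) (X : T -> R) :
  measurable_fun setT phi -> measurable_wrt G X -> measurable_wrt G (phi \o X).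
Proof.
move=> mphi mX B mB; rewrite comp_preimage; apply: mX.
by rewrite -[X in measurable X]setTI; exact: mphi.
Qed.

End sub_sigma_algebra.

(** * Optional stopping at the first occurrence *)

Section first_hit.
Context {d} {T : measurableType d} {R : realType} (P : probability T R).
Context {F : nat -> set_system T} (hF : is_filtration F).
Context {B : nat -> set T} (FB : forall t, F t (B t)).

Let sF t : sigma_algebra setT (F t). Proof. by case: hF. Qed.
Let mF t A : F t A -> measurable A. Proof. by case: hF => _ [+ _]; exact. Qed.

(* [B 0] is ignored, and [hit n] is the event that [B] first occurs at time [n.+1]. *)
Fixpoint survive (n : nat) : set T :=
  if n is m.+1 then survive m `\` B m.+1 else setT.

Definition hit n := survive n `&` B n.+1.

Lemma F_survive n : F n (survive n).
Proof.
elim: n => [|n IH] /=; first exact: sigma_algebra_setT.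
by apply: sigma_algebra_setD => //; case: hF => _ [_]; exact.
Qed.

Lemma measurable_survive n : measurable (survive n).
Proof. by apply: mF; exact: F_survive. Qed.

Lemma measurable_hit n : measurable (hit n).
Proof. by apply: measurableI; [exact: measurable_survive|exact: mF]. Qed.

Lemma survive_split n : survive n = hit n `|` survive n.+1.
Proof. by rewrite /hit /= setUC setDE -setIUr setvU setIT. Qed.

Lemma hit_disjoint n : [disjoint hit n & survive n.+1].
Proof.
by apply/disj_setPS => w [[_ Bw] [_ /(_ Bw)]].
Qed.

(** Optional stopping at the first occurrence truncated at [N], spelled out event by event. In the
    induction [hit N] and [survive N.+1] partition [survive N], an event of [F N], over which the
    integral of [L N.+1] is at most that of [L N]. *)
Lemma supermartingale_hit (L : nat -> T -> R) (N : nat) : supermartingale P F L ->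
  (\sum_(n < N) \int[P]_(w in hit n) (L n.+1 w)%:E +
   \int[P]_(w in survive N) (L N w)%:E <= \int[P]_w (L 0%N w)%:E)%E.
Proof.
move=> [_ [intL superL]].
have mL t : measurable_fun setT (EFin \o L t) by exact: measurable_int (intL t).
elim: N => [|N IH]; first by rewrite big_ord0 add0e.
apply: le_trans IH; rewrite big_ord_recr/= -addeA.
apply: leeD2l.
have -> : (\int[P]_(w in hit N) (L N.+1 w)%:E +
    \int[P]_(w in survive N `\` B N.+1) (L N.+1 w)%:E =
    \int[P]_(w in survive N) (L N.+1 w)%:E)%E.
  rewrite [in RHS]survive_split integral_setU//.
  - exact: measurable_hit.
  - exact: (measurable_survive N.+1).
  - by apply: measurable_funTS; exact: mL.
  - exact: hit_disjoint.
have [Y [[_ [intY YE]] YL]] := superL N.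
rewrite -(YE _ (F_survive N)).
apply: ae_le_integral => //.
- exact: measurable_survive.
- by apply: measurable_funTS; exact: measurable_int intY.
- by apply: measurable_funTS; exact: mL.
Qed.

End first_hit.
Arguments survive {d T} B n : simpl nomatch.
Arguments hit {d T} B n.

(** * Tonelli's theorem over measurable subsets *)

Section tonelli_on_sets.
Context {d1 d2} {T1 : measurableType d1} {T2 : measurableType d2} {R : realType}.
Variables (m1 : {sigma_finite_measure set T1 -> \bar R})
  (m2 : {sigma_finite_measure set T2 -> \bar R}).
Variables (A : set T1) (D : set T2) (f : T1 * T2 -> \bar R).
Hypotheses (mA : measurable A) (mD : measurable D).
Hypotheses (mf : measurable_fun setT f) (f0 : forall z, (0 <= f z)%E).

Let fA := f \_ (A `*` setT).
Let fAD := f \_ (A `*` D).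

Let mfA : measurable_fun setT fA.
Proof.
by apply/(measurable_restrictT f); [exact: measurableX|exact: measurable_funTS].
Qed.

Let mfAD : measurable_fun setT fAD.
Proof.
by apply/(measurable_restrictT f); [exact: measurableX|exact: measurable_funTS].
Qed.

(** Extending [f] by zero outside [A * setT] reduces this to the product of the full spaces. *)
Lemma measurable_fun_integral_left :
  measurable_fun setT (fun y => \int[m1]_(x in A) f (x, y))%E.
Proof.
have -> : (fun y => \int[m1]_(x in A) f (x, y))%E = fubini_G m1 fA.
  apply/funext => y; rewrite integral_mkcond; apply: eq_integral => x _.
  by rewrite /fA !patchE in_setX in_setT andbT.
apply: measurable_fun_fubini_tonelli_G; first exact: mfA.
by move=> z; exact: erestrict_ge0.
Qed.

Let fD := f \_ (setT `*` D).

Let mfD : measurable_fun setT fD.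
Proof.
by apply/(measurable_restrictT f); [exact: measurableX|exact: measurable_funTS].
Qed.

Lemma measurable_fun_integral_right :
  measurable_fun setT (fun x => \int[m2]_(y in D) f (x, y))%E.
Proof.
have -> : (fun x => \int[m2]_(y in D) f (x, y))%E = fubini_F m2 fD.
  apply/funext => x; rewrite integral_mkcond; apply: eq_integral => y _.
  by rewrite /fD !patchE in_setX in_setT.
apply: measurable_fun_fubini_tonelli_F; first exact: mfD.
by move=> z; exact: erestrict_ge0.
Qed.

Lemma tonelli_on_sets :
  (\int[m1]_(x in A) \int[m2]_(y in D) f (x, y) =
   \int[m2]_(y in D) \int[m1]_(x in A) f (x, y))%E.
Proof.
transitivity (\int[m1]_x \int[m2]_y fAD (x, y))%E.
  rewrite integral_mkcond; apply: eq_integral => x _; rewrite patchE.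
  case: ifPn => xA.
    rewrite integral_mkcond; apply: eq_integral => y _.
    by rewrite /fAD !patchE in_setX xA.
  by rewrite integral0_eq// => y _; rewrite /fAD patchE in_setX (negbTE xA).
have fAD0 z : (0 <= fAD z)%E by exact: erestrict_ge0.
rewrite (fubini_tonelli _ mfAD fAD0).
rewrite [RHS]integral_mkcond; apply: eq_integral => y _; rewrite patchE.
case: ifPn => yD.
  rewrite [RHS]integral_mkcond; apply: eq_integral => x _.
  by rewrite /fAD !patchE in_setX yD andbT.
by rewrite integral0_eq// => x _; rewrite /fAD patchE in_setX (negbTE yD) andbF.
Qed.

End tonelli_on_sets.

(** * Bounding the crossing probability by the mixture *)

Section mixture_bound.
Context {d} {T : measurableType d} {R : realType} (P : probability T R).
Context {F : nat -> set_system T} (hF : is_filtration F).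
Context {B : nat -> set T} (FB : forall t, F t (B t)).

Lemma adapted_measurable (X : nat -> T -> R) t : adapted F X -> measurable_fun setT (X t).
Proof.
move=> FX _ A mA; rewrite setTI.
by case: hF => _ [+ _]; apply; exact: FX.
Qed.

Let mhit := measurable_hit hF FB.
Let msurvive := measurable_survive hF FB.

(** On each [hit] event [L] is replaced by the exponential it dominates; the leftover integral over
    [survive B N] is dropped, since [L] is almost surely nonnegative. *)
Lemma sub_psi_hit (S V : nat -> T -> R) (psi : R -> R) (lmax : \bar R) (l0 lambda : R) (N : nat) :
  adapted F S -> adapted F V ->
  sub_psi P F lmax psi l0 S V -> 0 <= lambda -> (lambda%:E < lmax)%E ->
  (\sum_(n < N) \int[P]_(w in hit B n)
     (expR (lambda * S n.+1 w - psi lambda * V n.+1 w))%:E <= l0%:E)%E.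
Proof.
move=> FS FV SV lambda0 lmax0; have [L [superL [EL0 expL]]] := SV _ lambda0 lmax0.
have mL t : measurable_fun setT (EFin \o L t).
  by case: superL => _ [+ _] => /(_ t)/measurable_int.
have {EL0}EL0 : (\int[P]_w (L 0%N w)%:E <= l0%:E)%E by move: EL0; rewrite unlock.
apply: le_trans EL0; apply: le_trans (supermartingale_hit P hF FB L N superL).
apply: (@le_trans _ _ (\sum_(n < N) \int[P]_(w in hit B n) (L n.+1 w)%:E)%E).
  apply: lee_sum => n _; apply: ae_le_integral => //.
  - apply: measurable_funTS; apply/measurable_EFinP; apply: measurableT_comp => //.
    by apply: measurable_funB; apply: measurable_funM => //; exact: adapted_measurable.
  - by apply: measurable_funTS; exact: mL.
  - by apply: filterS (expL n.+1) => w; rewrite lee_fin.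
rewrite leeDl// -(integral0 P (survive B N)); apply: ae_le_integral => //.
- by apply: measurable_funTS; exact: mL.
- apply: filterS (expL N) => w /= /(le_trans _); rewrite lee_fin; apply.
  exact: expR_ge0.
Qed.

Lemma probability_hit_survive (N : nat) :
  (\sum_(n < N) P (hit B n) + P (survive B N) = 1)%E.
Proof.
elim: N => [|N IH]; first by rewrite big_ord0 add0e probability_setT.
rewrite -[RHS]IH big_ord_recr/= -addeA; congr (_ + _)%E.
rewrite [in RHS]survive_split measureU//.
exact/disj_set2P/hit_disjoint.
Qed.

Variables (S V : nat -> T -> R).
Hypotheses (hS : adapted F S) (hV : adapted F V).

(** Split on the sign of the tilt. When it is negative, the hypothesis on [- S] is used at the
    opposite value: the two signs cancel in the product and [psi_bernoulliN] matches the variance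
    terms. *)
Lemma sub_bernoulli_hit (g h l0 x : R) (N : nat) :
  sub_bernoulli P F g h l0 S V ->
  sub_bernoulli P F h g l0 (fun t w => - S t w) V ->
  (\sum_(n < N) \int[P]_(w in hit B n)
     (kernel g h (S n.+1 w) (V n.+1 w) x)%:E <= l0%:E)%E.
Proof.
move=> SB NSB; have [t0|/ltW t0] := leP 0 (tilt g h x).
  by apply: (sub_psi_hit _ _ _ _ _ _ _ hS hV SB) => //; rewrite ltry.
have hNS : adapted F (fun t w => - S t w).
  move=> t; apply: (measurable_wrt_comp _ (fun y : R => - y)); last exact: hS.
  exact: measurable_funN.
have Nt0 : 0 <= - tilt g h x by rewrite oppr_ge0.
have := sub_psi_hit _ _ _ _ _ _ N hNS hV NSB Nt0 (ltry _).
apply: le_trans; rewrite le_eqVlt; apply/orP; left; apply/eqP.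
apply: eq_bigr => n _; apply: eq_integral => w _.
by rewrite /kernel mulrNN psi_bernoulliN.
Qed.

Section integrated.
Variables (r g h l0 c : R).
Hypotheses (r0 : 0 < r) (g0 : 0 < g) (h0 : 0 < h) (l00 : 0 < l0) (c0 : 0 < c).
Hypothesis kernel_hit : forall x N,
  (\sum_(n < N) \int[P]_(w in hit B n)
     (kernel g h (S n.+1 w) (V n.+1 w) x)%:E <= l0%:E)%E.
Hypothesis B_crossed : forall t w, B t w ->
  (c%:E * mixture_integral r g h 0 0 <= mixture_integral r g h (S t w) (V t w))%E.

Let J0 := mixture_integral r g h 0 0.
Let phi n (z : T * R) : \bar R :=
  (kernel g h (S n.+1 z.1) (V n.+1 z.1) z.2 * weight r g h z.2)%:E.

Let mphi n : measurable_fun setT (phi n).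
Proof.
apply/measurable_EFinP; apply: measurable_funM.
  apply: measurable_kernel => //.
  - by apply: measurableT_comp; [exact: adapted_measurable|exact: measurable_fst].
  - by apply: measurableT_comp; [exact: adapted_measurable|exact: measurable_fst].
by apply: measurableT_comp; [exact: measurable_weight|exact: measurable_snd].
Qed.

Let phi0 n z : (0 <= phi n z)%E.
Proof. by rewrite lee_fin kernel_weight_ge0. Qed.

(** Tonelli moves the integral over [x] outside; for fixed [x] the inner sum is at most [l0], and
    integrating the weight gives [J0]. *)
Lemma hit_mixture_integral N :
  (\sum_(n < N) \int[P]_(w in hit B n)
     mixture_integral r g h (S n.+1 w) (V n.+1 w) <= l0%:E * J0)%E.
Proof.
pose D : set R := `]0, 1[%classic.
have mD : measurable D by exact: measurable_itv.
have -> : (\sum_(n < N) \int[P]_(w in hit B n)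
     mixture_integral r g h (S n.+1 w) (V n.+1 w) =
   \int[lebesgue_measure]_(x in D)
     \sum_(n < N) \int[P]_(w in hit B n) phi n (w, x))%E.
  rewrite ge0_integral_sum//.
  - apply: eq_bigr => n _.
    exact: (tonelli_on_sets P lebesgue_measure _ _ _
              (mhit n) mD (mphi n) (phi0 n)).
  - move=> n; apply: measurable_funTS.
    exact: (measurable_fun_integral_left P _ _ (mhit n) (mphi n) (phi0 n)).
  - by move=> n x _; exact: integral_ge0.
(* At [s = v = 0] the kernel is identically 1. *)
have J0E : J0 = (\int[lebesgue_measure]_(x in D) (weight r g h x)%:E)%E.
  apply: eq_integral => x _.
  by rewrite /kernel !mulr0 subr0 expR0 mul1r.
rewrite J0E -ge0_integralZl//; last 3 first.
- by apply: measurable_funTS; apply/measurable_EFinP; exact: measurable_weight.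
- by move=> x _; rewrite lee_fin weight_ge0.
- by rewrite lee_fin ltW.
apply: ge0_le_integral => //.
- by move=> x _; apply: sume_ge0 => n _; exact: integral_ge0.
- apply: emeasurable_sum => n; apply: measurable_funTS.
  exact: (measurable_fun_integral_left P _ _ (mhit n) (mphi n) (phi0 n)).
- apply: measurable_funeM; apply: measurable_funTS; apply/measurable_EFinP.
  exact: measurable_weight.
move=> x _.
have -> : (\sum_(n < N) \int[P]_(w in hit B n) phi n (w, x) =
   (weight r g h x)%:E * \sum_(n < N) \int[P]_(w in hit B n)
     (kernel g h (S n.+1 w) (V n.+1 w) x)%:E)%E.
  rewrite ge0_sume_distrr; last by move=> n _; apply: integral_ge0 => w _; rewrite lee_fin expR_ge0.
  apply: eq_bigr => n _; rewrite -ge0_integralZl//.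
  - by apply: eq_integral => w _; rewrite /phi -EFinM mulrC.
  - apply: measurable_funTS; apply/measurable_EFinP.
    by apply: measurable_kernel => //; exact: adapted_measurable.
  - by move=> w _; rewrite lee_fin expR_ge0.
  - by rewrite lee_fin weight_ge0.
by rewrite [leRHS]muleC; apply: lee_wpmul2l => //; rewrite lee_fin weight_ge0.
Qed.

(** A Markov-type bound: on each [hit] event the mixture is at least [c * J0], and [J0], being
    positive and finite, cancels. *)
Lemma probability_hit N : (\sum_(n < N) P (hit B n) <= (l0 / c)%:E)%E.
Proof.
have J0_gt0 := mixture_integral00_gt0 r _ _ g0 h0.
have J0_fin := mixture_integral00_fin_num _ _ _ r0 g0 h0.
have cJ0 : (c%:E * J0 * \sum_(n < N) P (hit B n) <= l0%:E * J0)%E.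
  apply: le_trans (hit_mixture_integral N).
  rewrite ge0_sume_distrr; last by move=> n _; exact: measure_ge0.
  apply: lee_sum => n _; rewrite -integral_cst; last exact: mhit.
  apply: ge0_le_integral => //.
  - by move=> w _; rewrite mule_ge0 ?lee_fin ?ltW.
  - apply: measurable_funTS.
    exact: (measurable_fun_integral_right lebesgue_measure _ _
              (measurable_itv _) (mphi n) (phi0 n)).
  - by move=> w [_ /B_crossed].
move: cJ0; rewrite /J0 -(fineK J0_fin).
have : (0 <= \sum_(n < N) P (hit B n))%E by apply: sume_ge0 => n _; exact: measure_ge0.
have : 0 < fine (mixture_integral r g h 0 0).
  by rewrite fine_gt0// J0_gt0 -ge0_fin_numE// ltW.
move: (fine _) (\sum_(n < N) _)%E => j [s| |] j0 //=.
- rewrite lee_fin => s0; rewrite -!EFinM !lee_fin => cjs.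
  rewrite ler_pdivlMr// -(ler_pM2r j0) (le_trans _ cjs)//.
  by rewrite le_eqVlt; apply/orP; left; apply/eqP; ring.
- by move=> _; rewrite -EFinM gt0_muley ?lte_fin ?mulr_gt0// -EFinM leye_eq.
Qed.

End integrated.

End mixture_bound.

(** * Infinite horizon and conclusion *)

Lemma bigcap_survive {d} {T : measurableType d} (B : nat -> set T) :
  \bigcap_n survive B n = [set w | forall t, (1 <= t)%N -> ~ B t w].
Proof.
apply/seteqP; split => w.
  by move=> sw [//|t] _; have [] := sw t.+1 I.
move=> Bw n _; elim: n => [//|n IH] /=.
by split => //; exact: Bw.
Qed.

(** Each survival event has probability at least [1 - a] by complementation; they decrease to the
    intersection, so continuity from above applies. *)
Lemma probability_bigcap_survive_ge {d} {T : measurableType d} {R : realType}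
    (P : probability T R) (F : nat -> set_system T) (B : nat -> set T) (a : R) :
  is_filtration F -> (forall t, F t (B t)) ->
  (forall N, (\sum_(n < N) P (hit B n) <= a%:E)%E) ->
  ((1 - a)%:E <= P (\bigcap_n survive B n))%E.
Proof.
move=> hF FB Pa.
have msurvive := measurable_survive hF FB.
have cvgP : P (survive B n) @[n --> \oo] --> P (\bigcap_n survive B n).
  apply: nonincreasing_cvg_mu => //.
  - by rewrite (le_lt_trans (probability_le1 _ _)) ?ltry.
  - exact: bigcap_measurable.
  - by apply/nonincreasing_seqP => n; rewrite subsetEset => w [].
rewrite -(cvg_lim _ cvgP)//; apply: lime_ge; first by apply/cvg_ex; eexists; exact: cvgP.
apply: nearW => n.
have := Pa n; have := probability_hit_survive P hF FB n.
have /fineK <- : P (survive B n) \is a fin_num by exact: fin_num_measure.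
case: (\sum_(i < n) _)%E => [s| |]//=.
by rewrite -EFinD => -[E]; rewrite !lee_fin; lra.
Qed.

Theorem proposition7 (R : realType) (d : measure_display)
    (T : measurableType d) (P : probability T R) (F : nat -> set_system T)
    (S V : nat -> T -> R) (g h l0 alpha rho : R)
    (hF : is_filtration F)
    (hS : adapted F S) (hV : adapted F V)
    (hS0 : forall w, S 0%N w = 0) (hV0 : forall w, V 0%N w = 0)
    (hVge0 : forall t w, 0 <= V t w)
    (hg : 0 < g) (hh : 0 < h) (hl0 : 1 <= l0) (halpha : 0 < alpha < 1)
    (hSB : sub_bernoulli P F g h l0 S V)
    (hNSB : sub_bernoulli P F h g l0 (fun t w => - S t w) V)
    (hrho : g * h < rho) :
  let r := rho - g * h in
  ((1 - alpha)%:E <=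
   P [set w | forall t : nat, (1 <= t)%N ->
        (- beta_binomial_boundary r l0 alpha h g (V t w) < S t w
           < beta_binomial_boundary r l0 alpha g h (V t w))%R])%E.
Proof.
cbv zeta; set r := rho - g * h.
have r0 : 0 < r by rewrite subr_gt0.
have l00 : 0 < l0 by exact: lt_le_trans hl0.
have /andP[a0 _] := halpha.
have c0 : 0 < l0 / alpha by rewrite divr_gt0.
(* The truncation gives a Borel function on the whole line and changes nothing at [V t w >= 0]. *)
pose f (a b v : R) := beta_binomial_boundary r l0 alpha a b (Num.max v 0).
have mf a b : 0 < a -> 0 < b -> measurable_fun setT (f a b).
  by move=> a_gt0 b_gt0; exact: measurable_boundary.
pose B t := [set w | f g h (V t w) <= S t w] `|` [set w | f h g (V t w) <= - S t w].
have FB t : F t (B t).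
  have sF : sigma_algebra setT (F t) by case: hF.
  apply: sigma_algebra_setU => //; apply: measurable_wrt_le => //.
  - by apply: measurable_wrt_comp => //; exact: mf.
  - by apply: measurable_wrt_comp => //; exact: mf.
  - apply: (measurable_wrt_comp _ (fun y : R => - y)); last exact: hS.
    exact: measurable_funN.
have B_crossed t w : B t w -> ((l0 / alpha)%:E * mixture_integral r g h 0 0 <=
    mixture_integral r g h (S t w) (V t w))%E.
  rewrite /B /f /= (max_idPl (hVge0 t w)) => -[fS|fS].
    exact: boundary_crossed.
  (* A lower crossing becomes an upper crossing by [- S] with [g] and [h] exchanged. *)
  rewrite -(mixture_integralN _ _ _ (S t w))// -(mixture_integralN _ _ _ 0)// oppr0.
  exact: boundary_crossed.
have -> : [set w | forall t : nat, (1 <= t)%N ->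
        (- beta_binomial_boundary r l0 alpha h g (V t w) < S t w
           < beta_binomial_boundary r l0 alpha g h (V t w))%R] =
    \bigcap_n survive B n.
  rewrite bigcap_survive; apply/seteqP.
  split => w /= Hw t t1; have := Hw t t1; rewrite /B /f /= (max_idPl (hVge0 t w)).
    by move=> /andP[Sl Su] []; rewrite leNgt ?Su// ltrNl Sl.
  move=> /not_orP[/negP + /negP]; rewrite -!ltNge => -> /=.
  by rewrite andbT ltrNl.
apply: (probability_bigcap_survive_ge P F) => // N.
(* The threshold is [c = l0 / alpha], so the bound [l0 / c] is [alpha]. *)
have -> : alpha = l0 / (l0 / alpha) by rewrite invf_div mulrCA divff ?mulr1// gt_eqF.
apply: (probability_hit P hF FB S V hS hV r g h) => // x n.
exact: (sub_bernoulli_hit P hF FB S V hS hV g h l0 x n hSB hNSB).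
Qed.
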